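(* Let $q$ be a prime power, $e\ge1$, $Q=q^e$, and let $n\ge0$, $k\ge1$, $\ell\ge1$ be integers with $\gcd(\ell,Q-1)\ne1$. Then $g_{n,q}^{(\ell)}\in\mathbb{F}_Q[X_1,\dots,X_k]$ is not a local permutation polynomial over $\mathbb{F}_Q$.
   Context: For a prime power $q$ (a power of the prime $p$) and an integer $n\ge 0$, $g_{n,q}\in\mathbb{F}_p[X]$ denotes the unique polynomial satisfying $\sum_{a\in\mathbb{F}_q}(X+a)^n=g_{n,q}(X^q-X)$. For $\ell\ge1$, $g_{n,q}^{(\ell)}(X_1,\dots,X_k)=g_{n,q}(X_1^\ell+X_2^\ell+\cdots+X_k^\ell)$. A univariate polynomial over $\mathbb{F}_Q$ is a permutation polynomial over $\mathbb{F}_Q$ if it induces a bijection of $\mathbb{F}_Q$. A polynomial $f\in\mathbb{F}_Q[X_1,\dots,X_k]$ is a local permutation polynomial if for each $1\le i\le k$ and all choices of $a_j\in\mathbb{F}_Q$ ($j\ne i$), the univariate polynomial $f(a_1,\dots,a_{i-1},X_i,a_{i+1},\dots,a_k)$ is a permutation polynomial over $\mathbb{F}_Q$. *)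

(* Defs.v *)
From HB Require Import structures.
From mathcomp Require Import all_boot all_order all_algebra all_fingroup all_solvable all_field.
From mathcomp Require Import mpoly.

Set Implicit Arguments.
Unset Strict Implicit.
Unset Printing Implicit Defensive.

Import GRing.Theory.
Local Open Scope ring_scope.

(* The canonical map from the prime field; a ring morphism whenever p is the
   characteristic of R. *)
Definition Fp_embed (p : nat) (R : nzRingType) (c : 'F_p) : R := (c : nat)%:R.

Definition gpoly_eq (p : nat) (F : finFieldType) (n : nat)
    (g : {poly 'F_p}) : bool :=
  \sum_(a : F) ('X + a%:P) ^+ n
    == map_poly (@Fp_embed p F) g \Po ('X^#|F| - 'X).

Section Gpoly.

Variables (p : nat) (F : finFieldType).
Hypothesis charF : p \in [pchar F].

Let q := #|F|.
Let S n : {poly F} := \sum_(a : F) ('X + a%:P) ^+ n.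

Let iota := in_alg (pPrimeCharType charF).

Let iotaE c : Fp_embed F c = iota c.
Proof. exact: esym (mulr1 _). Qed.

Lemma Fp_embed_is_nmod_morphism : nmod_morphism (@Fp_embed p F).
Proof. by split=> [|a b]; rewrite !iotaE; [exact: (raddf0 iota) | exact: (raddfD iota)]. Qed.

Lemma Fp_embed_is_monoid_morphism : monoid_morphism (@Fp_embed p F).
Proof. by split=> [|a b]; rewrite !iotaE; [exact: (rmorph1 iota) | exact: (rmorphM iota)]. Qed.

Definition Fp_rmorphism : {rmorphism 'F_p -> F} :=
  HB.pack (@Fp_embed p F)
    (GRing.isNmodMorphism.Build _ _ _ Fp_embed_is_nmod_morphism)
    (GRing.isMonoidMorphism.Build _ _ _ Fp_embed_is_monoid_morphism).

Let Fp_embed_map : exists phi : {rmorphism 'F_p -> F},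
  map_poly (@Fp_embed p F) =1 map_poly phi.
Proof. by exists Fp_rmorphism. Qed.

Let q_gt1 : (1 < q)%N.
Proof. exact: finNzRing_gt1. Qed.

Let q_eq0 : q%:R = 0 :> F.
Proof.
have: \sum_(a : F) (a + 1) = \sum_(a : F) a.
  by rewrite [RHS](reindex_inj (addIr 1)).
rewrite big_split sumr_const -/q /= => /eqP.
by rewrite -subr_eq0 addrAC subrr add0r => /eqP.
Qed.

Let q_pnat : p.-nat q.
Proof. by have := pprimeChar_pgroup charF; rewrite /pgroup cardsT. Qed.

Let power_sum0 k : (k < q.-1)%N -> \sum_(a : F) a ^+ k = 0.
Proof.
case: k => [|k] ltkq.
  by under eq_bigr do rewrite expr0; rewrite sumr_const q_eq0.
have [b b_neq0 bk_neq1] : exists2 b : F, b != 0 & b ^+ k.+1 != 1.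
  apply/exists_inP; apply: contraLR ltkq; rewrite -leqNgt => /exists_inPn H.
  have -> : q.-1 = size (enum [pred x : F | x != 0]).
    by rewrite -cardE (cardC1 (0 : F)).
  apply: (@max_unity_roots F) => //; last exact: enum_uniq.
  apply/allP=> x; rewrite mem_enum => /H; rewrite negbK.
  by rewrite unity_rootE.
have: (b ^+ k.+1 - 1) * \sum_(a : F) a ^+ k.+1 = 0.
  rewrite mulrBl mul1r mulr_sumr; apply/eqP; rewrite subr_eq0; apply/eqP.
  rewrite [RHS](reindex_inj (mulfI b_neq0)).
  by apply: eq_bigr => a _; rewrite exprMn.
by move/eqP; rewrite mulf_eq0 subr_eq0 (negPf bk_neq1) => /eqP.
Qed.

Let power_sum1 : \sum_(a : F) a ^+ q.-1 = -1.
Proof.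
rewrite (bigD1 0) //= expr0n eqn0Ngt -ltnS prednK ?q_gt1 // ?(ltnW q_gt1) //=.
rewrite add0r (eq_bigr (fun=> 1)) => [|a a_neq0].
  rewrite sumr_const (cardC1 (0 : F)) -/q -subn1.
  by rewrite natrB ?(ltnW q_gt1) // q_eq0 sub0r.
by apply: (mulfI a_neq0); rewrite -exprS prednK ?expf_card ?mulr1 // ltnW.
Qed.

Let S_expand n : S n = \sum_(i < n.+1)
  ('X^(n - i) * (\sum_(a : F) a ^+ i)%:P) *+ 'C(n, i).
Proof.
rewrite /S; under eq_bigr do rewrite exprDn.
rewrite exchange_big; apply: eq_bigr => i _ /=.
rewrite rmorph_sum mulr_sumr -sumrMnl; apply: eq_bigr => a _.
by rewrite rmorphXn.
Qed.

Lemma gpoly_exists n :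
  exists g : {poly 'F_p}, @gpoly_eq p F n g.
Proof.
rewrite /gpoly_eq; have [phi phiE] := Fp_embed_map.
suff [g gE] : exists g, S n = map_poly (@Fp_embed p F) g \Po ('X^q - 'X).
  by exists g; apply/eqP.
elim/ltn_ind: n => n IHn.
have [ltnq | leqn] := ltnP n q; last first.
  have [|g0 g0E] := IHn (n - q)%N.
    by rewrite ltn_subrL (ltnW q_gt1) (leq_trans (ltnW q_gt1)).
  have [|g1 g1E] := IHn (n - q).+1%N.
    by rewrite -[ltnRHS](subnK leqn) -addn2 leq_add2l.
  exists (g1 + 'X * g0); rewrite phiE rmorphD rmorphM /= map_polyX.
  rewrite comp_polyD comp_polyM comp_polyX -!phiE -g0E -g1E.
  rewrite /S mulr_sumr -big_split; apply: eq_bigr => a _ /=.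
  have: ('X + a%:P) ^+ q = 'X + a%:P + ('X^q - 'X) :> {poly F}.
    rewrite exprDn_pchar; last first.
      rewrite (eq_pnat _ (@pchar_poly F)) (eq_pnat _ (pcharf_eq charF)).
      exact: q_pnat.
    by rewrite -rmorphXn /= expf_card [RHS]addrAC addrCA subrr addr0.
  rewrite -{1}(subnK leqn) exprD => ->.
  by rewrite exprS -mulrDl mulrC.
have : (n <= q.-1)%N by rewrite -ltnS prednK // ltnW.
rewrite leq_eqVlt => /predU1P[nE | ltn]; rewrite S_expand.
  exists (- 1)%:P; rewrite phiE map_polyC comp_polyC /= rmorphN1.
  rewrite big_ord_recr /= subnn binn mul1r nE power_sum1 big1 ?add0r //.
  by move=> i _; rewrite power_sum0 // mulr0 mul0rn.
exists 0; rewrite phiE rmorph0 comp_poly0 big1 // => i _.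
rewrite power_sum0 ?polyC0 ?mulr0 ?mul0rn //.
by rewrite (leq_trans (ltn_ord i)).
Qed.

(* g_{n,q} with q = #|F|; it is the only solution by gpoly_unique below. *)
Definition gpoly (n : nat) : {poly 'F_p} :=
  xchoose (gpoly_exists n).

Lemma gpolyP n :
  \sum_(a : F) ('X + a%:P) ^+ n
    = map_poly (@Fp_embed p F) (gpoly n) \Po ('X^#|F| - 'X).
Proof. exact/eqP/(xchooseP (gpoly_exists n)). Qed.

Lemma gpoly_unique n (g : {poly 'F_p}) :
  \sum_(a : F) ('X + a%:P) ^+ n
    = map_poly (@Fp_embed p F) g \Po ('X^#|F| - 'X) ->
  g = gpoly n.
Proof.
have [phi phiE] := Fp_embed_map.
rewrite gpolyP !phiE => /eqP.
rewrite -subr_eq0 -comp_polyB -rmorphB /= => /eqP comp0.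
have size_u : size ('X^q - 'X : {poly F}) = q.+1.
  by rewrite size_polyDl size_polyXn // size_polyN size_polyX ltnS.
have: map_poly phi (gpoly n - g) = 0.
  move: comp0; set d := map_poly _ _ => comp0.
  have := size_comp_poly d ('X^q - 'X).
  rewrite comp0 size_poly0 size_u /= => /esym/eqP.
  rewrite muln_eq0 -[q == 0%N]negbK -lt0n (ltnW q_gt1) orbF => /eqP size_d.
  have dE : d = (d`_0)%:P by apply: size1_polyC; rewrite (leq_trans (leqSpred _)) ?size_d.
  by move: comp0; rewrite dE comp_polyC.
by move/eqP; rewrite map_poly_eq0 subr_eq0 => /eqP.
Qed.

End Gpoly.

Definition permutation_poly (F : finFieldType) (f : {poly F}) : Prop :=
  bijective (fun x : F => f.[x]).

(* f(a_1, ..., a_(i-1), X, a_(i+1), ..., a_k); the value of a at i is ignored. *)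
Definition specialize_except (F : finFieldType) (k : nat) (f : {mpoly F[k]})
    (i : 'I_k) (a : 'I_k -> F) : {poly F} :=
  mmap (@polyC F) (fun j => if j == i then 'X else (a j)%:P) f.

Definition local_permutation_poly (F : finFieldType) (k : nat)
    (f : {mpoly F[k]}) : Prop :=
  forall (i : 'I_k) (a : 'I_k -> F), permutation_poly (specialize_except f i a).

(* g(X_1^l + ... + X_k^l), with coefficients read in K. *)
Definition power_sum_subst (p : nat) (K : finFieldType) (k l : nat)
    (g : {poly 'F_p}) : {mpoly K[k]} :=
  (map_poly (fun c : 'F_p => (Fp_embed K c)%:MP_[k]) g).[\sum_(i < k) 'X_i ^+ l].

(* Main.v *)
(* At a = 0 the specialized polynomial evaluates to g(x^l), so it suffices that
   x |-> x^l is not injective on the units of F_Q. Put d = gcd(l, Q - 1) > 1 and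
   m = (Q - 1) / d: every unit satisfies (x^m)^l = 1, so injectivity would make
   all Q - 1 units roots of X^m - 1, although m < Q - 1. *)
Require Import Defs.
From mathcomp Require Import all_boot all_order all_algebra all_field.
From mathcomp Require Import mpoly.

Import GRing.Theory.

Lemma expf_not_injective (F : finFieldType) (l : nat) :
  gcdn l #|F|.-1 <> 1 -> ~ injective (fun x : F => x ^+ l)%R.
Proof.
have F_gt0 : 0 < #|F|.-1 by rewrite -subn1 subn_gt0 finNzRing_gt1.
set d := gcdn _ _ => d_neq1 inj_l.
have d_gt1 : 1 < d.
  by rewrite ltn_neqAle eq_sym gcdn_gt0 F_gt0 orbT andbT; apply/eqP.
have dF : d %| #|F|.-1 by exact: dvdn_gcdr.
have m_gt0 : 0 < #|F|.-1 %/ d by rewrite divn_gt0 ?(ltnW d_gt1) // dvdn_leq.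
have unit_root (x : F) : (x != 0 -> x ^+ (#|F|.-1 %/ d) = 1)%R.
  move=> x_neq0; apply: inj_l; rewrite expr1n -exprM.
  have xF : (x ^+ #|F|.-1 = 1)%R.
    apply: (mulfI x_neq0).
    by rewrite -exprS prednK ?expf_card ?mulr1 // ltnW ?finNzRing_gt1.
  (* As [d] divides both [l] and [#|F|.-1], the quotient moves over to [l]: the exponent becomes
     [#|F|.-1 * (l %/ d)]. *)
  by rewrite divn_mulAC // -muln_divA ?dvdn_gcdl // exprM xF expr1n.
have : #|F|.-1 <= #|F|.-1 %/ d.
  rewrite -{1}(cardC1 (0 : F)%R) cardE.
  apply: (@max_unity_roots F) => //; last exact: enum_uniq.
  by apply/allP=> x; rewrite mem_enum => /unit_root xm; rewrite unity_rootE xm.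
by rewrite leqNgt ltn_Pdiv.
Qed.

(** Specialization and evaluation are ring morphisms, so they pass through to the variables. *)
Lemma horner_specialize_power_sum (p k l : nat) (K : finFieldType)
    (g : {poly 'F_p}) (i : 'I_k) (a : 'I_k -> K) (x : K) :
  ((specialize_except (power_sum_subst K k l g) i a).[x]
    = (map_poly (@Fp_embed p K) g).[
        \sum_(j < k) (if j == i then x else a j) ^+ l])%R.
Proof.
(* With no assumption on the characteristic of [K], [Fp_embed] may fail to be a morphism; hence the
   comparison coefficient by coefficient. *)
rewrite /specialize_except /power_sum_subst /map_poly !horner_poly.
rewrite rmorph_sum horner_sum; apply: eq_bigr => m _ /=.
rewrite rmorphM rmorphXn rmorph_sum /= mmapC hornerM hornerC horner_exp horner_sum.
congr (_ * _ ^+ _)%R; apply: eq_bigr => j _.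
rewrite rmorphXn horner_exp /= mmapX mmap1U.
by case: ifP => _; rewrite ?hornerX ?hornerC.
Qed.

Theorem theorem5p11 (p q e Q n k l : nat) (Fq FQ : finFieldType)
    (charFq : p \in [pchar Fq]%R) (cardFq : #|Fq| = q)
    (e_ge1 : 1 <= e) (def_Q : Q = q ^ e) (cardFQ : #|FQ| = Q)
    (k_ge1 : 1 <= k) (l_ge1 : 1 <= l) (gcd_neq1 : gcdn l (Q - 1) <> 1) :
  ~ local_permutation_poly
      (power_sum_subst FQ k l (gpoly charFq n)).
Proof.
move/(_ (Ordinal k_ge1) (fun=> 0%R))/bij_inj => inj_spec.
apply: (@expf_not_injective FQ l); first by rewrite cardFQ -subn1.
move=> x y xy; apply: inj_spec; rewrite !horner_specialize_power_sum.
(* The summands agree by [xy] at the free index and are identical elsewhere. *)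
by congr (_.[_])%R; apply: eq_bigr => j _; case: (j == _).
Qed.
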